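(* Let $r\in\mathbb{N}$ and let $G=(g_1,\ldots,g_r)$ be any system of polynomials with integer coefficients. Then the function $(m_1,\ldots,m_r)\mapsto E_G(m_1,\ldots,m_r)$ on $\mathbb{N}^r$ is integer valued and multiplicative.
   Context: For $n\in\mathbb{N}$ and $k\in\mathbb{Z}$, $c_n(k)=\sum_{1\le j\le n,\ \gcd(j,n)=1}\exp(2\pi i jk/n)$ is the Ramanujan sum. For $m_1,\ldots,m_r\in\mathbb{N}$ with $m=\operatorname{lcm}(m_1,\ldots,m_r)$, $E_G(m_1,\ldots,m_r)=\frac1m\sum_{k=1}^m c_{m_1}(g_1(k))\cdots c_{m_r}(g_r(k))$. A function $f:\mathbb{N}^r\to\mathbb{C}$ is called multiplicative if it is not identically zero and $f(m_1n_1,\ldots,m_rn_r)=f(m_1,\ldots,m_r)f(n_1,\ldots,n_r)$ for all $m_i,n_i\in\mathbb{N}$ with $\gcd(m_1\cdots m_r,n_1\cdots n_r)=1$. *)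

(* Defs.v *)
From mathcomp Require Import all_boot all_order all_algebra.
From mathcomp Require Import all_classical all_reals all_analysis.
From mathcomp Require Import complex.

Set Implicit Arguments.
Unset Strict Implicit.
Unset Printing Implicit Defensive.

Import Order.TTheory GRing.Theory Num.Theory.

Local Open Scope ring_scope.
Local Open Scope complex_scope.

Definition expC (R : realType) (z : R[i]) : R[i] :=
  (expR (complex.Re z))%:C * (cos (complex.Im z) +i* sin (complex.Im z)).

(* y *i is the complex number 0 + i y. *)
Definition ramanujan_sum (R : realType) (n : nat) (k : int) : R[i] :=
  \sum_(1 <= j < n.+1 | coprime j n)
    expC ((2 * pi * j%:R * k%:~R / n%:R : R) *i).

(* Here N = {1, 2, ...}: N^r is the set of m : 'I_r -> nat with positive
   entries; values of functions outside that set are irrelevant. *)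
Definition pos_tuple (r : nat) (m : 'I_r -> nat) : Prop :=
  forall i, (0 < m i)%N.

Definition lcm_tuple (r : nat) (m : 'I_r -> nat) : nat :=
  \big[lcmn/1%N]_(i < r) m i.

Definition E_of (R : realType) (r : nat) (G : 'I_r -> {poly int})
    (m : 'I_r -> nat) : R[i] :=
  ((lcm_tuple m)%:R)^-1 *
  \sum_(1 <= k < (lcm_tuple m).+1)
    \prod_(i < r) ramanujan_sum R (m i) (G i).[k%:Z].

Definition integer_valued (R : realType) (r : nat)
    (f : ('I_r -> nat) -> R[i]) : Prop :=
  forall m, pos_tuple m -> exists z : int, f m = z%:~R.

Definition multiplicative_tuple (R : realType) (r : nat)
    (f : ('I_r -> nat) -> R[i]) : Prop :=
  (exists2 m, pos_tuple m & f m <> 0) /\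
  (forall m n, pos_tuple m -> pos_tuple n ->
     coprime (\prod_(i < r) m i)%N (\prod_(i < r) n i)%N ->
     f (fun i => (m i * n i)%N) = f m * f n).

(* Main.v *)
Require Import Defs.
From mathcomp Require Import all_boot all_order all_algebra.
From mathcomp Require Import all_classical all_reals all_analysis.
From mathcomp Require Import complex ring lra.

(** Moebius inversion and the orthogonality of roots of unity give
    [c_n(k) = \sum_(d | n) mu(n/d) d [d | k]].  Expanding the product in [E_G]
    yields a [Z]-combination of terms [d_1 ... d_r * N(d) / lcm(d)], where [N(d)]
    counts the [k] modulo [lcm(d)] with [d_i | g_i(k)] for all [i]; these are
    integers because [lcm(d)] divides [d_1 ... d_r].  Multiplicativity is the
    Chinese remainder theorem, applied once to the index [j] of the Ramanujan
    sum and once to the summation variable [k] of [E_G]. *)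

Set Implicit Arguments.
Unset Strict Implicit.
Unset Printing Implicit Defensive.

Import Order.TTheory GRing.Theory Num.Theory.

Local Open Scope ring_scope.

(** * Moebius function and sums over divisors *)

(* [mobius_upto N] is the Moebius function on [1, N]: the recursion
   [mu(N) = [N = 1] - \sum_(d | N, d < N) mu(d)] made structural. *)
Fixpoint mobius_upto (N : nat) : nat -> int :=
  if N isn't N'.+1 then fun=> 0 else
  fun n => if n == N
    then (N == 1%N)%:Z - \sum_(d <- divisors N | d != N) mobius_upto N' d
    else mobius_upto N' n.

Definition mobius (n : nat) : int := mobius_upto n n.

Lemma mobius_uptoE (N n : nat) : (n <= N)%N -> mobius_upto N n = mobius n.
Proof.
elim: N => [|N IHN]; first by rewrite leqn0 => /eqP ->.
rewrite leq_eqVlt ltnS => /predU1P[-> //|le_nN] /=.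
by rewrite ltn_eqF ?ltnS // IHN.
Qed.

Lemma sum_mobius (n : nat) :
  (0 < n)%N -> \sum_(d <- divisors n) mobius d = (n == 1%N)%:Z.
Proof.
case: n => // n _.
have n_in : n.+1 \in divisors n.+1 by rewrite -dvdn_divisors.
(* Unfolding only the term [d = n.+1] exposes the recursion, which subtracts exactly the remaining
   terms of the sum. *)
rewrite (bigD1_seq n.+1) ?divisors_uniq //= {1}/mobius /= eqxx.
rewrite -[RHS]addr0 -addrA; congr (_ + _).
apply/eqP; rewrite addrC subr_eq0; apply/eqP.
rewrite big_seq_cond [RHS]big_seq_cond; apply: eq_bigr => d /andP[].
rewrite -dvdn_divisors // => /dvdn_leq -/(_ isT) le_dn neq_dn.
by rewrite mobius_uptoE // -ltnS ltn_neqAle neq_dn.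
Qed.

(** The divisors of [n] that divide [j] are the divisors of [gcdn j n], so [sum_mobius] detects
    whether this gcd is 1. *)
Lemma sum_mobius_gcd (n j : nat) : (0 < n)%N ->
  \sum_(d <- divisors n | (d %| j)%N) mobius d = (coprime j n)%:Z.
Proof.
move=> n_gt0; have g_gt0 : (0 < gcdn j n)%N by rewrite gcdn_gt0 n_gt0 orbT.
rewrite /coprime -sum_mobius // -big_filter; apply: perm_big.
apply: uniq_perm; rewrite ?filter_uniq ?divisors_uniq // => d.
by rewrite mem_filter -!dvdn_divisors // dvdn_gcd.
Qed.

Lemma sum_divisors_div (V : nmodType) (n : nat) (F : nat -> V) : (0 < n)%N ->
  \sum_(d <- divisors n) F (n %/ d)%N = \sum_(d <- divisors n) F d.
Proof.
move=> n_gt0; rewrite -(big_map (fun d => n %/ d)%N xpredT F).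
have divK d : d \in divisors n -> (n %/ (n %/ d))%N = d.
  rewrite -dvdn_divisors // => d_n.
  by rewrite divnA // mulKn.
apply: perm_big; apply: uniq_perm; rewrite ?divisors_uniq //.
  rewrite map_inj_in_uniq ?divisors_uniq // => x y xn yn eq_xy.
  by rewrite -(divK x) // eq_xy divK.
have sub d : d \in divisors n -> (n %/ d)%N \in divisors n.
  by rewrite -!dvdn_divisors //; exact: dvdn_div.
move=> d; apply/mapP/idP => [[x /sub ? -> //]|dn].
by exists (n %/ d)%N; rewrite ?sub ?divK.
Qed.

(** Gives divisor sums of different numbers a common finite index type, as needed to distribute a
    product over them. *)
Lemma sum_divisors_ord (V : nmodType) (n B : nat) (F : nat -> V) :
  (0 < n < B)%N -> \sum_(d <- divisors n) F d = \sum_(d < B | (d %| n)%N) F d.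
Proof.
move=> /andP[n_gt0 lt_nB].
rewrite -(big_mkord (fun d => d %| n)%N F) -big_filter.
apply: perm_big; apply: uniq_perm.
- exact: divisors_uniq.
- by rewrite filter_uniq ?iota_uniq.
move=> d; rewrite mem_filter mem_index_iota -dvdn_divisors //=.
by case: (boolP (d %| n)%N) => //= /dvdn_leq -/(_ n_gt0) /leq_ltn_trans ->.
Qed.

(** * Sums of periodic functions and the Chinese remainder theorem *)

Definition periodic_mod (T : Type) (n : nat) (F : nat -> T) : Prop :=
  forall k, F (k %% n)%N = F k.

Lemma sum_shift_periodic (V : nmodType) (n : nat) (F : nat -> V) :
  periodic_mod n F -> \sum_(1 <= k < n.+1) F k = \sum_(k < n) F k.
Proof.
move=> perF; case: n perF => [|n] perF; first by rewrite big_geq // big_ord0.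
rewrite big_add1 /= big_nat_recr //= -(perF n.+1) modnn addrC.
by rewrite -(big_mkord xpredT F) big_nat_recl.
Qed.

Lemma sum_multiples (V : nmodType) (d e : nat) (F : nat -> V) : (0 < d)%N ->
  \sum_(k < d * e | (d %| k)%N) F k = \sum_(k < e) F (d * k)%N.
Proof.
move=> d_gt0; rewrite big_mkcond /=.
elim: e => [|e IHe]; first by rewrite muln0 !big_ord0.
rewrite mulnSr big_split_ord /= IHe big_ord_recr /=; congr (_ + _).
case: d d_gt0 {IHe} => // d _.
rewrite big_ord_recl /= addn0 dvdn_mulr // big1 ?addr0 // => k _.
by rewrite dvdn_addr ?dvdn_mulr // gtnNdvd // /bump /= ltnS.
Qed.

Lemma sum_periodic_mul (V : nmodType) (L q : nat) (F : nat -> V) :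
  periodic_mod L F -> \sum_(k < L * q) F k = (\sum_(k < L) F k) *+ q.
Proof.
move=> perF; elim: q => [|q IHq]; first by rewrite muln0 big_ord0.
rewrite mulnSr big_split_ord /= IHq mulrSr; congr (_ + _).
by apply: eq_bigr => k _; rewrite -perF mulnC modnMDl perF.
Qed.

(** The map [k] to [(k %% m, k %% n)] is injective between sets of equal size, hence a bijection
    that reindexes the double sum. *)
Lemma sum_chinese (A : comPzRingType) (m n : nat) (F H : nat -> A) :
  coprime m n -> periodic_mod m F -> periodic_mod n H ->
  \sum_(k < m * n) F k * H k = (\sum_(k < m) F k) * (\sum_(k < n) H k).
Proof.
move=> co_mn perF perH.
have [mn0|] := posnP (m * n).
  move/eqP: (mn0); rewrite muln_eq0 mn0 big_ord0 => /orP[]/eqP ->.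
    by rewrite big_ord0 mul0r.
  by rewrite big_ord0 mulr0.
rewrite muln_gt0 => /andP[m_gt0 n_gt0].
rewrite big_distrlr /= pair_big /=.
pose h (k : 'I_(m * n)) := (Ordinal (ltn_pmod k m_gt0), Ordinal (ltn_pmod k n_gt0)).
have h_inj : injective h.
  move=> j k [/eqP jk_m /eqP jk_n]; apply/val_inj => /=.
  have := chinese_remainder co_mn j k; rewrite jk_m jk_n => /eqP.
  by rewrite !modn_small.
rewrite (reindex h) /=; last first.
  by apply/onW_bij/inj_card_bij; rewrite ?card_prod ?card_ord.
by apply: eq_bigr => k _; rewrite perF perH.
Qed.

(** * Congruences *)

(** Over the integers ['X - b] divides [G - G.[b]]; evaluate the factorisation at [a]. *)
Lemma horner_eqmod (G : {poly int}) (d : int) (a b : int) :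
  (d %| a - b)%Z -> (d %| G.[a] - G.[b])%Z.
Proof.
move=> d_ab.
have /factor_theorem[q Gq] : root (G - G.[b]%:P) b.
  by rewrite /root hornerD hornerN hornerC subrr.
have -> : G.[a] - G.[b] = (G - G.[b]%:P).[a] by rewrite hornerD hornerN hornerC.
by rewrite Gq hornerM hornerXsubC dvdz_mull.
Qed.

Lemma dvdz_modn_sub (n k : nat) : (n%:Z %| (k %% n)%N%:Z - k%:Z)%Z.
Proof. by rewrite -eqz_mod_dvd !modz_nat modn_mod. Qed.

Lemma dvdz_congr (d : int) (a b : int) :
  (d %| a - b)%Z -> (d %| a)%Z = (d %| b)%Z.
Proof. by move=> dab; rewrite -[a in LHS](subrK b) rpredDl. Qed.

(** * Roots of unity and their orthogonality *)

Section RootsOfUnity.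
Variable R : realType.

Local Open Scope complex_scope.

(* [exp(2 pi i t / n)]; equal to [1] for [n = 0] since [t / 0 = 0]. *)
Definition unity (n : nat) (t : int) : R[i] :=
  expC ((2 * pi * t%:~R / n%:R : R) *i).

Lemma expC_im (x : R) : expC (x *i) = cos x +i* sin x.
Proof. by rewrite /expC /= expR0 mul1r. Qed.

Lemma unity0 (n : nat) : unity n 0 = 1.
Proof. by rewrite /unity expC_im mulr0 mul0r cos0 sin0. Qed.

Lemma unityD (n : nat) (s t : int) : unity n (s + t) = unity n s * unity n t.
Proof.
rewrite /unity !expC_im intrD mulrDr mulrDl cosD sinD.
by apply/eqP; rewrite eq_complex /= eqxx addrC [cos _ * sin _]mulrC mulrC eqxx.
Qed.

Lemma unityMn (n : nat) (t : int) (j : nat) : unity n (j%:Z * t) = unity n t ^+ j.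
Proof.
elim: j => [|j IHj]; first by rewrite mul0r unity0.
by rewrite intS mulrDl mul1r unityD IHj exprS.
Qed.

Lemma unity_scale (n d : nat) (t : int) : (0 < d)%N ->
  unity (d * n) (d%:Z * t) = unity n t.
Proof.
move=> d_gt0; rewrite /unity !expC_im.
suff -> : 2 * pi * (d%:Z * t)%:~R / (d * n)%:R = 2 * pi * t%:~R / n%:R :> R by [].
have d0 : d%:R != 0 :> R by rewrite pnatr_eq0 -lt0n.
by rewrite intrM natrM -pmulrn mulrCA -mulf_div divff // mul1r.
Qed.

Lemma unity_self (n : nat) : (0 < n)%N -> unity n n%:Z = 1.
Proof.
move=> n_gt0; rewrite /unity expC_im -pmulrn mulfK ?pnatr_eq0 -?lt0n //.
by rewrite mulr_natl cos2pi sin2pi.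
Qed.

Lemma unity_eqmod (n : nat) (s t : int) : (0 < n)%N ->
  (n%:Z %| s - t)%Z -> unity n s = unity n t.
Proof.
move=> n_gt0 /dvdzP[q st].
suff unityq : unity n (q * n%:Z) = 1.
  by rewrite -(subrK t s) st unityD unityq mul1r.
have posq j : unity n (j%:Z * n%:Z) = 1 by rewrite unityMn unity_self ?expr1n.
(* For negative [q], the value at [q * n] is the inverse of a value already known to be 1. *)
case: q {st} => j; first exact: posq.
have := unityD n (Negz j * n%:Z) (j.+1%:Z * n%:Z).
by rewrite -mulrDl NegzE addNr mul0r unity0 posq mulr1 => <-.
Qed.

Lemma unity_neq1 (n : nat) (t : int) : (0 < n)%N ->
  ~~ (n%:Z %| t)%Z -> unity n t != 1.
Proof.
move=> n_gt0 n_t.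
have nz : n%:Z != 0 by rewrite -lt0n.
have n0 : 0 < n%:R :> R by rewrite ltr0n.
rewrite (@unity_eqmod n t (t %% n%:Z)%Z) //; last by rewrite -eqz_mod_dvd modz_mod.
set s := (t %% n%:Z)%Z.
have s_lt : s < n%:Z by rewrite ltz_mod.
have s_gt : 0 < s.
  by rewrite lt_def modz_ge0 // andbT; apply: contra n_t => /eqP/dvdz_mod0P.
have sn : (s%:~R : R) < n%:R by rewrite -(ltr_int R) in s_lt.
have s0 : 0 < (s%:~R : R) by rewrite ltr0z.
(* Half the angle: [x] lies strictly between 0 and [pi], so [sin x > 0] and
   [cos (2 x) = 1 - 2 (sin x)^2 < 1]. *)
set x := pi * s%:~R / n%:R : R.
rewrite /unity expC_im.
have -> : 2 * pi * s%:~R / n%:R = x *+ 2 by rewrite /x -[RHS]mulr_natl !mulrA.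
apply/eqP => -[cosx1 _].
have : 0 < sin x.
  apply: sin_gt0_pi; rewrite divr_gt0 ?mulr_gt0 ?pi_gt0 //=.
  by rewrite ltr_pdivrMr // ltr_pM2l // pi_gt0.
move: cosx1; rewrite cos_mulr2n cos2sin2 => h; nra.
Qed.

Lemma sum_unity (n : nat) (t : int) : (0 < n)%N ->
  \sum_(j < n) unity n (j%:Z * t) = (n%:Z * (n%:Z %| t)%Z%:Z)%:~R.
Proof.
move=> n_gt0; under eq_bigr do rewrite unityMn.
case: (boolP (n%:Z %| t)%Z) => [n_t|n_t].
  rewrite (@unity_eqmod n t 0) ?subr0 // unity0.
  by under eq_bigr do rewrite expr1n; rewrite sumr_const card_ord mulr1.
(* Geometric sum: with [z = unity n t], the product of [z - 1] and the sum is [z ^+ n - 1 = 0],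
   while [z != 1]. *)
apply/eqP; rewrite mulr0; have := subrX1 (unity n t) n.
have -> : unity n t ^+ n = 1.
  by rewrite -unityMn -(unity0 n) (@unity_eqmod n _ 0) // subr0 dvdz_mulr.
rewrite subrr => /esym/eqP; rewrite mulf_eq0 subr_eq0.
by rewrite (negPf (unity_neq1 _ _)).
Qed.

(** * Ramanujan sums *)

Lemma ramanujan_sum_ord (n : nat) (k : int) : (0 < n)%N ->
  ramanujan_sum R n k = \sum_(j < n) (coprime j n)%:R * unity n (j%:Z * k).
Proof.
move=> n_gt0.
rewrite -(@sum_shift_periodic _ _ (fun j => (coprime j n)%:R * unity n (j%:Z * k))).
  rewrite /ramanujan_sum big_mkcond; apply: eq_bigr => j _.
  rewrite /unity intrM -pmulrn [2 * pi * (_ * _)]mulrA.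
  by case: coprime; rewrite ?mul1r ?mul0r.
move=> j; rewrite coprime_modl; congr (_ * _); apply: unity_eqmod => //.
by rewrite -mulrBl dvdz_mulr ?dvdz_modn_sub.
Qed.

Lemma ramanujan_sumE (n : nat) (k : int) : (0 < n)%N ->
  ramanujan_sum R n k =
  (\sum_(d <- divisors n) mobius (n %/ d) * (d%:Z * (d%:Z %| k)%Z%:Z))%:~R.
Proof.
move=> n_gt0; rewrite ramanujan_sum_ord //.
under eq_bigr => j _.
  rewrite -[(coprime _ _)%:R]/((coprime _ _)%:Z%:~R) -sum_mobius_gcd // rmorph_sum.
  rewrite mulr_suml big_mkcond /=.
  over.
rewrite exchange_big /=.
rewrite -(@sum_divisors_div _ n (fun d => mobius (n %/ d) * (d%:Z * (d%:Z %| k)%Z%:Z))) //.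
rewrite rmorph_sum /= big_seq [RHS]big_seq; apply: eq_bigr => d.
rewrite -dvdn_divisors // => d_n; rewrite -big_mkcond /= -mulr_sumr.
have d_gt0 := dvdn_gt0 n_gt0 d_n.
(* With [n = d * e], the indices divisible by [d] are [d * j] for [j < e], and their terms are
   [e]-th roots of unity, summing to [e] or 0 by orthogonality. *)
have /dvdnP[e ne] := d_n; rewrite mulnC in ne.
have e_gt0 : (0 < e)%N by move: n_gt0; rewrite ne muln_gt0 => /andP[].
rewrite ne mulKn // mulnK // intrM -sum_unity //; congr (_ * _).
rewrite (sum_multiples _ (fun j => unity (d * e) (j%:Z * k))) //.
by apply: eq_bigr => j _; rewrite PoszM -mulrA unity_scale.
Qed.

Lemma ramanujan_sum_eqmod (n : nat) (k l : int) : (0 < n)%N ->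
  (n%:Z %| k - l)%Z -> ramanujan_sum R n k = ramanujan_sum R n l.
Proof.
move=> n_gt0 n_kl; rewrite !ramanujan_sumE //; congr (_ %:~R).
rewrite big_seq [RHS]big_seq; apply: eq_bigr => d; rewrite -dvdn_divisors // => d_n.
by rewrite (@dvdz_congr _ k l) //; apply: dvdz_trans n_kl.
Qed.

(** In the divisor formula only the conditions [d %| k] involve [k], and [u] is coprime to every
    divisor [d] of [n]. *)
Lemma ramanujan_sum_unit (n : nat) (k u : int) : (0 < n)%N ->
  coprimez n%:Z u -> ramanujan_sum R n (k * u) = ramanujan_sum R n k.
Proof.
move=> n_gt0 co_nu; rewrite !ramanujan_sumE //; congr (_ %:~R).
rewrite big_seq [RHS]big_seq; apply: eq_bigr => d; rewrite -dvdn_divisors // => d_n.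
by rewrite Gauss_dvdzl //; apply: coprimez_dvdl co_nu.
Qed.

Lemma ramanujan_sumM (m n : nat) (k : int) : (0 < m)%N -> (0 < n)%N ->
  coprime m n ->
  ramanujan_sum R (m * n) k = ramanujan_sum R m k * ramanujan_sum R n k.
Proof.
move=> m_gt0 n_gt0 co_mn.
(* With [v m + u n = 1], [e(jk/mn) = e(jku/m) e(jkv/n)], and [u], [v] are
   units modulo [m], [n]. *)
have /coprimezP[[v u] /= uv1] : coprimez m%:Z n%:Z by rewrite coprimezE.
rewrite -(@ramanujan_sum_unit m k u) //; last first.
  by apply/coprimezP; exists (v, n%:Z) => /=; rewrite -uv1 [n%:Z * _]mulrC.
rewrite -(@ramanujan_sum_unit n k v) //; last first.
  by apply/coprimezP; exists (u, m%:Z) => /=; rewrite -uv1 [m%:Z * _]mulrC addrC.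
rewrite !ramanujan_sum_ord ?muln_gt0 ?m_gt0 //.
have per p l : (0 < p)%N ->
    periodic_mod p (fun j => (coprime j p)%:R * unity p (j%:Z * l)).
  move=> p_gt0 j; rewrite coprime_modl; congr (_ * _); apply: unity_eqmod => //.
  by rewrite -mulrBl dvdz_mulr ?dvdz_modn_sub.
rewrite -(sum_chinese co_mn (per _ _ m_gt0) (per _ _ n_gt0)).
apply: eq_bigr => j _; rewrite coprimeMr -mulnb natrM [RHS]mulrACA; congr (_ * _).
rewrite -(@unity_scale m n) // -(@unity_scale n m) // [(n * m)%N]mulnC -unityD.
by congr unity; rewrite -[LHS]mulr1 -uv1; ring.
Qed.

End RootsOfUnity.

(** * Least common multiples of tuples *)

Lemma dvdn_lcm_tuple (r : nat) (m : 'I_r -> nat) (i : 'I_r) :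
  (m i %| lcm_tuple m)%N.
Proof. by exact: (biglcmn_sup i). Qed.

Lemma lcm_tuple_dvd (r : nat) (m : 'I_r -> nat) (M : nat) :
  (forall i, m i %| M)%N -> (lcm_tuple m %| M)%N.
Proof.
by move=> mM; apply/dvdn_biglcmP => i _.
Qed.

Lemma lcm_tuple_gt0 (r : nat) (m : 'I_r -> nat) :
  pos_tuple m -> (0 < lcm_tuple m)%N.
Proof.
move=> m_gt0; rewrite /lcm_tuple; elim/big_ind: _ => // x y x0 y0.
by rewrite lcmn_gt0 x0.
Qed.

Lemma lcm_tuple_dvd_prod (r : nat) (m : 'I_r -> nat) :
  (lcm_tuple m %| \prod_(i < r) m i)%N.
Proof. by apply: lcm_tuple_dvd => i; rewrite (bigD1 i) //= dvdn_mulr. Qed.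

Lemma coprime_lcm_tuple (r : nat) (m n : 'I_r -> nat) :
  coprime (\prod_(i < r) m i)%N (\prod_(i < r) n i)%N ->
  coprime (lcm_tuple m) (lcm_tuple n).
Proof.
move=> co; apply: (coprime_dvdl (lcm_tuple_dvd_prod m)).
exact: (coprime_dvdr (lcm_tuple_dvd_prod n)).
Qed.

Lemma lcm_tupleM (r : nat) (m n : 'I_r -> nat) :
  coprime (\prod_(i < r) m i)%N (\prod_(i < r) n i)%N ->
  lcm_tuple (fun i => m i * n i)%N = (lcm_tuple m * lcm_tuple n)%N.
Proof.
move=> co; apply/eqP; rewrite eqn_dvd; apply/andP; split.
  by apply: lcm_tuple_dvd => i; rewrite dvdn_mul ?dvdn_lcm_tuple.
rewrite Gauss_dvd ?coprime_lcm_tuple //; apply/andP; split;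
  apply: lcm_tuple_dvd => i; apply: dvdn_trans (dvdn_lcm_tuple _ i).
  exact: dvdn_mulr.
exact: dvdn_mull.
Qed.

(** * Multiplicativity of the average *)

Section AverageOfRamanujanSums.
Variables (R : realType) (r : nat) (G : 'I_r -> {poly int}).

(** Reducing [k] modulo the lcm changes each polynomial value by a multiple of [m i], which the
    Ramanujan sum of modulus [m i] ignores. *)
Lemma prod_ramanujan_periodic (m : 'I_r -> nat) : pos_tuple m ->
  periodic_mod (lcm_tuple m)
    (fun k => \prod_(i < r) ramanujan_sum R (m i) (G i).[k%:Z]).
Proof.
move=> m_gt0 k; apply: eq_bigr => i _; apply: ramanujan_sum_eqmod => //.
apply/horner_eqmod/(dvdz_trans _ (dvdz_modn_sub _ _)).
exact: dvdn_lcm_tuple.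
Qed.

Lemma E_of_ord (m : 'I_r -> nat) : pos_tuple m ->
  E_of R G m = (lcm_tuple m)%:R^-1 *
    \sum_(k < lcm_tuple m) \prod_(i < r) ramanujan_sum R (m i) (G i).[k%:Z].
Proof.
by move=> m_gt0; rewrite /E_of (sum_shift_periodic (prod_ramanujan_periodic m_gt0)).
Qed.

Lemma E_of_1 : E_of R G (fun=> 1%N) = 1.
Proof.
have lcm1 : lcm_tuple (fun _ : 'I_r => 1%N) = 1%N.
  by apply/eqP; rewrite -dvdn1; apply: lcm_tuple_dvd.
rewrite E_of_ord // lcm1 big_ord1 invr1 mul1r big1 // => i _.
by rewrite ramanujan_sum_ord // big_ord1 mul0r unity0 mulr1.
Qed.

Lemma E_ofM (m n : 'I_r -> nat) : pos_tuple m -> pos_tuple n ->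
  coprime (\prod_(i < r) m i)%N (\prod_(i < r) n i)%N ->
  E_of R G (fun i => (m i * n i)%N) = E_of R G m * E_of R G n.
Proof.
move=> m_gt0 n_gt0 co.
have mn_gt0 : pos_tuple (fun i => m i * n i)%N.
  by move=> i; rewrite muln_gt0 m_gt0 n_gt0.
rewrite !E_of_ord // lcm_tupleM // natrM invfM mulrACA; congr (_ * _).
rewrite -(sum_chinese (coprime_lcm_tuple co) (prod_ramanujan_periodic m_gt0)
  (prod_ramanujan_periodic n_gt0)).
apply: eq_bigr => k _; rewrite -big_split /=; apply: eq_bigr => i _.
apply: ramanujan_sumM => //.
apply: (@coprime_dvdl _ (\prod_(i < r) m i)); first by rewrite (bigD1 i) //= dvdn_mulr.
apply: (@coprime_dvdr _ (\prod_(i < r) n i)) co; by rewrite (bigD1 i) //= dvdn_mulr.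
Qed.

(** * Integrality of the average *)

Definition solves (d : 'I_r -> nat) (k : nat) : bool :=
  [forall i, ((d i)%:Z %| (G i).[k%:Z])%Z].

Lemma solves_periodic (d : 'I_r -> nat) : periodic_mod (lcm_tuple d) (solves d).
Proof.
move=> k; apply: eq_forallb => i; apply: dvdz_congr; apply: horner_eqmod.
by apply/(dvdz_trans _ (dvdz_modn_sub _ _)); exact: dvdn_lcm_tuple.
Qed.

Lemma solution_density_int (m d : 'I_r -> nat) :
  pos_tuple m -> (forall i, d i %| m i)%N ->
  exists z : int, (lcm_tuple m)%:R^-1 *
    \sum_(k < lcm_tuple m) (\prod_(i < r) d i)%:R * (solves d k)%:R
  = z%:~R :> R[i].
Proof.
move=> m_gt0 dm.
have d_gt0 : pos_tuple d by move=> i; apply: dvdn_gt0 (dm i).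
have /dvdnP[q lcmE] : (lcm_tuple d %| lcm_tuple m)%N.
  apply: lcm_tuple_dvd => i.
  exact: dvdn_trans (dm i) (dvdn_lcm_tuple _ _).
have /dvdnP[t prodE] := lcm_tuple_dvd_prod d.
have q_gt0 : (0 < q)%N.
  by have := lcm_tuple_gt0 m_gt0; rewrite lcmE muln_gt0 => /andP[].
have L0 : (lcm_tuple d)%:R != 0 :> R[i] by rewrite pnatr_eq0 -lt0n lcm_tuple_gt0.
have q0 : q%:R != 0 :> R[i] by rewrite pnatr_eq0 -lt0n.
(* Here [t] is the product of the [d i] over their lcm. The range splits into [q] periods of length
   [lcm_tuple d], and both [q] and that lcm cancel against the denominator. *)
exists (t * \sum_(k < lcm_tuple d) (solves d k : nat))%N%:Z.
rewrite -mulr_sumr lcmE mulnC prodE (@sum_periodic_mul _ _ _ (fun k => (solves d k)%:R)); last first.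
  by move=> k; rewrite solves_periodic.
rewrite -pmulrn !natrM natr_sum -mulr_natr.
by field; rewrite L0 q0.
Qed.

Lemma E_of_int (m : 'I_r -> nat) : pos_tuple m -> exists z : int, E_of R G m = z%:~R.
Proof.
move=> m_gt0; rewrite E_of_ord //.
(* One strict bound for all [m i], so that every divisor sum runs over ['I_B] and the product
   expands over functions [f] from ['I_r] to ['I_B]. *)
pose B := (\sum_(i < r) m i).+1.
have mB i : (0 < m i < B)%N.
  by rewrite m_gt0 ltnS /= (bigD1 i) //= leq_addr.
under eq_bigr => k _.
  under eq_bigr => i _.
    rewrite ramanujan_sumE // rmorph_sum /= (sum_divisors_ord _ (mB i)).
    over.
  rewrite bigA_distr_big_dep /=.
  over.
rewrite exchange_big mulr_sumr /=.
(* Integers are closed under sums, so a single choice [f] of divisors [f i] of [m i] remains to be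
   treated. *)
elim/big_ind: _ => [|x y [a ->] [b ->]|f /familyP fm].
- by exists 0.
- by exists (a + b); rewrite intrD.
have [|z zE] := @solution_density_int m (fun i => f i : nat) m_gt0.
  by move=> i; exact: fm i.
exists ((\prod_(i < r) mobius (m i %/ f i)) * z).
rewrite intrM -zE mulrCA; congr (_ * _); rewrite mulr_sumr.
apply: eq_bigr => k _.
have -> : (solves (fun i => f i : nat) k)%:R =
    \prod_(i < r) (((f i : nat)%:Z %| (G i).[k%:Z])%Z%:R : R[i]).
  rewrite /solves; case: forallP => [sol|/forallP/forallPn[i /negPf nsol]].
    by rewrite big1 // => i _; rewrite sol.
  by rewrite (bigD1 i) //= nsol mul0r.
rewrite natr_prod rmorph_prod -!big_split /=.
by apply: eq_bigr => i _; rewrite !intrM.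
Qed.

End AverageOfRamanujanSums.

Theorem corollary1 (R : realType) (r : nat) (hr : (0 < r)%N)
    (G : 'I_r -> {poly int}) :
  integer_valued (E_of R G) /\ multiplicative_tuple (E_of R G).
Proof.
split; first by move=> m; exact: E_of_int.
split; last exact: E_ofM.
(* The all-ones tuple, where the average is 1, witnesses that the function is not identically
   zero. *)
by exists (fun=> 1%N) => //; rewrite E_of_1; apply/eqP/oner_neq0.
Qed.
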